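(* Let $0<\lambda<1$, let $g$ be a piecewise smooth real function, and let $f(x,y)=\big(x+y+g(x),\ \lambda(y+g(x))\big)$. Let $G=G^-\cup G^+\subset\mathbb{R}^2$ be an open region, where $G^+$ (respectively $G^-$) consists of points $(x,y)$ such that $x$ lies in an open interval on which $g$ is smooth with positive (respectively negative) derivative. Put $d(x)=g'(x)$. Suppose there is $\varepsilon>0$ such that $$d(x)\ge\varepsilon \ \text{ at every point of } G^+,\qquad d(x)<-2(1+\lambda)\ \text{ at every point of } G^-.$$ Then $f$ is hyperbolic in $G$, with the following unstable and stable invariant cones (the same at every point of $G$): $$K^u=\Big\{0<\frac{u_2}{u_1}<2\lambda\Big\},\qquad K^s=\Big\{-\frac{1}{1-\lambda}<\frac{u_1}{u_2}<\frac{1}{1+\lambda}\Big\},$$ where $(u_1,u_2)$ are the local (tangent) coordinates at a point of $G$.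
   Context: Tangent vectors at a point are $\mathbf{u}=(u_1,u_2)\in\mathbb{R}^2$. $K^u$ and $K^s$ denote the sets of (nonzero) vectors $\mathbf u$ satisfying the displayed inequalities. The linearization of $f$ at $(x,y)\in G$ is $$Df=\begin{pmatrix}1+d(x)&1\\ \lambda d(x)&\lambda\end{pmatrix}.$$ ''$f$ is hyperbolic in $G$ with cones $K^u$, $K^s$'' means: the cones $K^u,K^s$ are one and the same at all points of $G$, and at every point of $G$ one has $Df\,K^u\subset K^u$ and $Df^{-1}K^s\subset K^s$ (where $Df^{-1}$ is the inverse of the linearization at that point), with the linearization expanding in $K^u$ and contracting in $K^s$. That is, $Df$ increases the length of every vector of $K^u$, and $Df^{-1}$ increases the length of every vector of $K^s$ (lengths in the Euclidean norm). *)

(* Defs.v *)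
From HB Require Import structures.
From mathcomp Require Export all_boot all_order all_algebra.
From mathcomp Require Export all_classical all_reals all_analysis.
Export Order.TTheory GRing.Theory Num.Theory.
Export numFieldNormedType.Exports.

Set Implicit Arguments.
Unset Strict Implicit.
Unset Printing Implicit Defensive.

Local Open Scope ring_scope.
Local Open Scope classical_set_scope.

(* Points and tangent vectors of the plane are row vectors; u 0 0 and u 0 1 are
   the coordinates (x, y), respectively (u_1, u_2). *)
Definition vec2 (R : realType) (a b : R) : 'rV[R]_2 :=
  \row_(j < 2) [:: a; b]`_j.

(* The library norm on matrices is the sup norm. *)
Definition euclidean_norm (R : realType) (u : 'rV[R]_2) : R :=
  Num.sqrt (u 0 0 ^+ 2 + u 0 1 ^+ 2).

(* Class C^r, with [Some m] for C^m and [None] for C^oo. Meant for open A: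
   the derivatives are then determined by the values of g on A. *)
Definition smooth_on (R : realType) (r : option nat) (g : R -> R)
    (A : set R) : Prop :=
  let le_r n := if r is Some m then (n <= m)%N else true in
  forall x, A x ->
    (forall n, le_r n.+1 -> derivable g^`(n) x 1) /\
    (forall n, le_r n -> {for x, continuous g^`(n)}).

(* Nothing is asked at the break points, where g may even jump. *)
Definition piecewise_smooth (R : realType) (r : option nat) (g : R -> R) :
    Prop :=
  exists S : set R,
    (forall a b : R, finite_set (S `&` `[a, b])) /\ smooth_on r g (~` S).

Definition planar_map (R : realType) (lambda : R) (g : R -> R)
    (p : 'rV[R]_2) : 'rV[R]_2 :=
  vec2 (p 0 0 + p 0 1 + g (p 0 0)) (lambda * (p 0 1 + g (p 0 0))).

(* [jacobian f p] represents the differential of f acting on row vectors from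
   the right: it is the transpose of the matrix acting on columns. *)
Definition lin (R : realType) (f : 'rV[R]_2 -> 'rV[R]_2) (p u : 'rV[R]_2) :
    'rV[R]_2 :=
  u *m jacobian f p.

Definition lin_inv (R : realType) (f : 'rV[R]_2 -> 'rV[R]_2)
    (p u : 'rV[R]_2) : 'rV[R]_2 :=
  u *m invmx (jacobian f p).

(* The first two clauses make [lin] and [lin_inv] meaningful: [jacobian] and
   [invmx] are total, with junk values. That the cones are the same at all
   points is expressed by Ku and Ks not depending on p. *)
Definition hyperbolic_with_cones (R : realType) (f : 'rV[R]_2 -> 'rV[R]_2)
    (G Ku Ks : set 'rV[R]_2) : Prop :=
  forall p, G p ->
    [/\ differentiable f p,
        jacobian f p \in unitmx,
        lin f p @` Ku `<=` Ku /\ lin_inv f p @` Ks `<=` Ks,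
        forall u, Ku u -> euclidean_norm u < euclidean_norm (lin f p u) &
        forall u, Ks u -> euclidean_norm u < euclidean_norm (lin_inv f p u)].

(* Since x / 0 = 0, the condition u 0 1 != 0 of [stable_cone] is needed: without
   it, horizontal vectors would be in the cone. *)
Definition unstable_cone (R : realType) (lambda : R) : set 'rV[R]_2 :=
  [set u : 'rV[R]_2 | u 0 0 != 0 /\ 0 < u 0 1 / u 0 0 < 2 * lambda].

Definition stable_cone (R : realType) (lambda : R) : set 'rV[R]_2 :=
  [set u : 'rV[R]_2 | u 0 1 != 0 /\
           - (1 - lambda)^-1 < u 0 0 / u 0 1 < (1 + lambda)^-1].

Definition increasing_strips (R : realType) (r : option nat) (g : R -> R) :
    set 'rV[R]_2 :=
  [set p : 'rV[R]_2 | exists a b : R, [/\ a < p 0 0 < b, smooth_on r g `]a, b[ &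
                              forall t, a < t < b -> 0 < g^`() t]].

Definition decreasing_strips (R : realType) (r : option nat) (g : R -> R) :
    set 'rV[R]_2 :=
  [set p : 'rV[R]_2 | exists a b : R, [/\ a < p 0 0 < b, smooth_on r g `]a, b[ &
                              forall t, a < t < b -> g^`() t < 0]].

(* Main.v *)
From HB Require Import structures.
Require Import Defs.
From mathcomp Require Import ring lra.
Local Open Scope ring_scope.
Local Open Scope classical_set_scope.

(** The map is linear in x and y + g(x), so its differential at p is the map
    of the same form built on the linear function t |-> d t, where d = g'(x):
    it sends (u_1, u_2) to (u_1 + w, lambda w) with w = d u_1 + u_2.  This has
    an explicit inverse ([lin_planar_map]), and both act on slopes by Moebius
    transformations, so that everything reduces to inequalities in one slope
    ([unstable_cone_step], [stable_cone_step]).  At each point of the region,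
    d > 0 or d < -2 (1 + lambda).

    Write t = u_2 / u_1 and s = d + t.  Then Df multiplies u_1 by 1 + s and
    turns the slope t into lambda s / (1 + s).  On the unstable cone, d > 0
    gives s > t > 0, and d < -2 (1 + lambda) gives s < -2; in these two ranges
    s / (1 + s) lies in ]0, 1[ and ]1, 2[ respectively, hence invariance, while
    (1 + s)^2 + (lambda s)^2 exceeds 1 + t^2, hence expansion.

    For the inverse write q = u_1 / u_2 and m = 1 / lambda - q.  Then Df^-1
    sends (q, 1) to (- m, 1 / lambda + d m), and q is in the stable cone exactly
    when 1 / (lambda m) lies strictly between 1 - lambda and 1 + lambda.  The
    new ratio is - 1 / (1 / (lambda m) + d), which the two hypotheses on d send
    back into the cone, in its negative half if d > 0 and in its positive half
    if d < -2 (1 + lambda).  In both cases |1 / lambda + d m| > 1 / lambda, which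
    is enough for expansion.  *)

(** * The differential of the map and its inverse *)

Lemma vec2_0 (R : realType) (a b : R) : vec2 a b 0 0 = a.
Proof. by rewrite mxE. Qed.

Lemma vec2_1 (R : realType) (a b : R) : vec2 a b 0 1 = b.
Proof. by rewrite mxE. Qed.

Lemma vec2_eta (R : realType) (u : 'rV[R]_2) : vec2 (u 0 0) (u 0 1) = u.
Proof.
apply/rowP => j; rewrite mxE; case: j => [[|[|//]] /= hj];
  by congr (u _ _); apply: val_inj.
Qed.

Lemma is_diff_coord (R : realType) (n : nat) (j : 'I_n) (p : 'rV[R]_n) :
  is_diff p (fun q : 'rV[R]_n => q 0 j : R) (fun u => u 0 j).
Proof.
apply: DiffDef; first exact: differentiable_coord.
have lin_coord : linear (fun q : 'rV[R]_n => q 0 j : R).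
  by move=> a u v; rewrite !mxE.
pose c := HB.pack_for {linear 'rV[R]_n -> R} (fun q : 'rV[R]_n => q 0 j : R)
  (GRing.isLinear.Build _ _ _ _ _ lin_coord).
exact: (@diff_lin _ _ _ c p (@coord_continuous _ _ _ _ _)).
Qed.

Lemma is_diff_planar_map (R : realType) (lambda : R) (g : R -> R)
    (p : 'rV[R]_2) : derivable g (p 0 0) 1 ->
  is_diff p (planar_map lambda g) (planar_map lambda ( *%R (g^`() (p 0 0))%classic)).
Proof.
move=> dg; set d : R := g^`() _.
have Dx := is_diff_coord R 2 0 p; have Dy := is_diff_coord R 2 1 p.
have Dg : is_diff (p 0 0) g ( *:%R^~ d).
  apply: DiffDef; last exact: deriv1E.
  exact/derivable1_diffP.
have Dgx := @is_diff_comp _ _ _ _ _ _ _ _ p Dx Dg.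
have Dw := is_diffD Dy Dgx.
(* In this form, scalar functions multiply constant vectors, so that only
   scalar functions remain to be differentiated. *)
have planarE h : planar_map lambda h =
    (fun q : 'rV[R]_2 => (q 0 0 : R) *: vec2 1 0) +
    (fun q : 'rV[R]_2 => (q 0 1 + h (q 0 0)) *: vec2 1 lambda).
  apply/funext => q; rewrite -[LHS]vec2_eta -[RHS]vec2_eta.
  by congr vec2; rewrite !mxE /=; ring.
rewrite !planarE.
apply: is_diffD.
  apply: DiffDef; first by apply: differentiableZl; exact: ex_diff.
  by rewrite diffZl ?diff_val //; exact: ex_diff.
apply: DiffDef.
  by apply: differentiableZl; exact: (@ex_diff _ _ _ _ _ _ _ Dw).
rewrite diffZl; last exact: (@ex_diff _ _ _ _ _ _ _ Dw).
rewrite (@diff_val _ _ _ _ _ _ _ Dw).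
by apply/funext => u /=; rewrite [in RHS]mulrC.
Qed.

(** The values of M on the standard basis are the rows of a left inverse of J,
    which for a square matrix is the inverse.  Linearity of M follows, and this
    is what makes it enough to exhibit a preimage of each vector. *)
Lemma invmx_of_section (R : realType) (n : nat) (J : 'M[R]_n)
    (M : 'rV[R]_n -> 'rV[R]_n) : (forall u, M u *m J = u) ->
  J \in unitmx /\ forall u, u *m invmx J = M u.
Proof.
move=> MJ; have unitJ : J \in unitmx.
  pose K := \matrix_i M (row i 1%:M).
  suff /mulmx1_unit[] : K *m J = 1%:M by [].
  by apply/row_matrixP => i; rewrite row_mul rowK MJ.
by split=> // u; rewrite -{1}[u]MJ mulmxK.
Qed.

Lemma planar_map_linearK (R : realType) (lambda d : R) (v : 'rV[R]_2) :
  lambda != 0 ->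
  planar_map lambda ( *%R d)
    (vec2 (v 0 0 - v 0 1 / lambda)
          (v 0 1 / lambda - d * (v 0 0 - v 0 1 / lambda))) = v.
Proof.
move=> l0; rewrite /planar_map !vec2_0 !vec2_1 -[RHS]vec2_eta.
by congr vec2; field.
Qed.

Lemma lin_planar_map (R : realType) (lambda : R) (g : R -> R)
    (p : 'rV[R]_2) : lambda != 0 -> derivable g (p 0 0) 1 ->
  let f := planar_map lambda g in let d := g^`() (p 0 0) in
  [/\ differentiable f p, jacobian f p \in unitmx,
      forall u, lin f p u = planar_map lambda ( *%R d) u &
      forall v, lin_inv f p v =
        vec2 (v 0 0 - v 0 1 / lambda)
             (v 0 1 / lambda - d * (v 0 0 - v 0 1 / lambda))].
Proof.
move=> l0 /(is_diff_planar_map _ lambda) Df f d.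
have linE u : lin f p u = planar_map lambda ( *%R d) u.
  by rewrite /lin /jacobian mul_rV_lin1 diff_val.
have [] := invmx_of_section _ _ (jacobian f p) (fun v =>
  vec2 (v 0 0 - v 0 1 / lambda)
       (v 0 1 / lambda - d * (v 0 0 - v 0 1 / lambda))).
  by move=> v; rewrite -[LHS]/(lin f p _) linE planar_map_linearK.
by move=> unitJ invE; split=> //; exact: ex_diff.
Qed.

(** * Action on the cones *)

Lemma euclidean_norm_lt (R : realType) (u v : 'rV[R]_2) :
  u 0 0 ^+ 2 + u 0 1 ^+ 2 < v 0 0 ^+ 2 + v 0 1 ^+ 2 ->
  euclidean_norm u < euclidean_norm v.
Proof.
move=> uv; rewrite ltr_sqrt //.
by apply: le_lt_trans uv; rewrite addr_ge0 ?sqr_ge0.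
Qed.

Lemma homogeneous_lt (R : realType) (c x y : R) : c != 0 -> x < y ->
  c ^+ 2 * x < c ^+ 2 * y.
Proof. by move=> c0 xy; rewrite ltr_pM2l // exprn_even_gt0. Qed.

(** Both cones are unions of lines through 0, and Df is homogeneous: with
    u = u_1 (1, t), the factor u_1 cancels from the slope and factors out of the
    squared lengths. *)
Lemma unstable_cone_step (R : realType) (lambda d : R) (u : 'rV[R]_2) :
  0 < lambda < 1 -> 0 < d \/ d < - (2 * (1 + lambda)) ->
  unstable_cone lambda u ->
  unstable_cone lambda (planar_map lambda ( *%R d) u) /\
  euclidean_norm u < euclidean_norm (planar_map lambda ( *%R d) u).
Proof.
move=> /andP[l0 l1] hd [u0 /andP[]]; set t := u 0 1 / u 0 0 => t0 t1.
have u1E : u 0 1 = u 0 0 * t by rewrite /t; field.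
pose s := d + t.
(* The cone bound t < 2 lambda and the constant -2 (1 + lambda) combine to
   -2, the point below which s / (1 + s) < 2. *)
have hs : t < s \/ s < - 2 by rewrite /s; case: hd => hd; [left|right]; lra.
have s1 : 1 + s != 0 by case: hs => ?; apply/eqP; lra.
split.
  rewrite /unstable_cone /= /planar_map vec2_0 vec2_1 u1E.
  rewrite (_ : _ + _ = u 0 0 * (1 + s)); last by rewrite /s; ring.
  split; first by rewrite mulf_neq0.
  rewrite (_ : _ / _ = lambda * (s / (1 + s))); last by rewrite /s; field; apply/andP.
  have [r0 r2] : 0 < s / (1 + s) /\ s / (1 + s) < 2.
    case: hs => hs.
      by rewrite ltr_pdivrMr ?divr_gt0; lra.
    rewrite -mulrNN -invrN ltr_pdivrMr ?divr_gt0; lra.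
  by rewrite mulr_gt0 //= [ltRHS]mulrC ltr_pM2l.
apply: euclidean_norm_lt; rewrite /planar_map vec2_0 vec2_1 u1E.
rewrite [ltLHS](_ : _ = u 0 0 ^+ 2 * (1 + t ^+ 2)); last by ring.
rewrite [ltRHS](_ : _ = u 0 0 ^+ 2 * ((1 + s) ^+ 2 + lambda ^+ 2 * s ^+ 2));
  last by rewrite /s; ring.
apply: homogeneous_lt => //.
case: hs => hs.
  have : t ^+ 2 < s ^+ 2 by rewrite ltr_sqr ?nnegrE; lra.
  have : 0 <= lambda ^+ 2 * s ^+ 2 by rewrite -exprMn sqr_ge0.
  nra.
have : t ^+ 2 < lambda ^+ 2 * s ^+ 2.
  rewrite -exprMn -[ltRHS]sqrrN ltr_sqr ?nnegrE; nra.
have : 1 < (1 + s) ^+ 2 by nra.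
lra.
Qed.

(** With v = v_2 (q, 1), the image is v_2 (- m, m (k + d)) where
    m = 1 / lambda - q and k = 1 / (lambda m).  In terms of k the cone is the
    interval |k - 1| < lambda, and d only enters as a shift of k. *)
Lemma stable_cone_step (R : realType) (lambda d : R) (v : 'rV[R]_2) :
  0 < lambda < 1 -> 0 < d \/ d < - (2 * (1 + lambda)) ->
  stable_cone lambda v ->
  let w := vec2 (v 0 0 - v 0 1 / lambda)
                (v 0 1 / lambda - d * (v 0 0 - v 0 1 / lambda)) in
  stable_cone lambda w /\ euclidean_norm v < euclidean_norm w.
Proof.
move=> /andP[l0 l1] hd [v1 /andP[]]; set q := v 0 0 / v 0 1 => q0 q1 w.
have v0E : v 0 0 = v 0 1 * q by rewrite /q; field.
have ln0 : lambda != 0 by rewrite gt_eqF.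
pose m := lambda^-1 - q.
(* The two ends of the cone, expressed in terms of m. *)
have lb : lambda^-1 - (1 + lambda)^-1 = (lambda * (1 + lambda))^-1.
  by field; apply/andP; split; apply/eqP; lra.
have ub : lambda^-1 + (1 - lambda)^-1 = (lambda * (1 - lambda))^-1.
  by field; apply/andP; split; apply/eqP; lra.
have m_gt : (lambda * (1 + lambda))^-1 < m by rewrite -lb /m; lra.
have m_lt : m < (lambda * (1 - lambda))^-1 by rewrite -ub /m; lra.
have m0 : 0 < m.
  by apply: le_lt_trans m_gt; rewrite invr_ge0 mulr_ge0; lra.
have lm0 : 0 < lambda * m by rewrite mulr_gt0.
pose k := (lambda * m)^-1.
have k0 : 0 < k by rewrite invr_gt0.
have k_lt : k < 1 + lambda.
  rewrite /k -[ltRHS]invrK ltf_pV2 ?posrE ?invr_gt0 //; last by lra.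
  move: m_gt; rewrite invfM mulrC ltr_pdivrMr // => h.
  by rewrite mulrC.
have k_gt : 1 - lambda < k.
  rewrite /k -[ltLHS]invrK ltf_pV2 ?posrE ?invr_gt0 //; last by lra.
  by move: m_lt; rewrite invfM mulrC ltr_pdivlMr // => h; rewrite mulrC.
have hk : 1 - lambda < k + d \/ k + d < - (1 + lambda).
  by case: hd => hd; [left|right]; lra.
have kd0 : k + d != 0 by case: hk => ?; apply/eqP; lra.
have mn0 : m != 0 by rewrite gt_eqF.
have w0 : w 0 0 = - (v 0 1 * m) by rewrite /w vec2_0 v0E /m; field.
have w1 : w 0 1 = v 0 1 * (m * (k + d)).
  rewrite /w vec2_1 v0E.
  have -> : v 0 1 * q - v 0 1 / lambda = - (v 0 1 * m) by rewrite /m; ring.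
  by rewrite /k; field; apply/andP.
split.
  split; first by rewrite w1 !mulf_neq0.
  have -> : w 0 0 / w 0 1 = - (k + d)^-1.
    by rewrite w0 w1; field; apply/and3P.
  case: hk => hk.
    have kd_gt0 : 0 < k + d by lra.
    apply/andP; split; first by rewrite ltrN2 ltf_pV2 ?posrE //; lra.
    apply: (@lt_trans _ _ 0); first by rewrite oppr_lt0 invr_gt0.
    by rewrite invr_gt0; lra.
  rewrite -(invrN (k + d)); apply/andP; split.
    apply: (@lt_trans _ _ 0); first by rewrite oppr_lt0 invr_gt0; lra.
    by rewrite invr_gt0; lra.
  by rewrite ltf_pV2 ?posrE; lra.
apply: euclidean_norm_lt; rewrite w0 w1 v0E.
rewrite [ltLHS](_ : _ = v 0 1 ^+ 2 * (q ^+ 2 + 1)); last by ring.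
rewrite [ltRHS](_ : _ = v 0 1 ^+ 2 * (m ^+ 2 + (m * (k + d)) ^+ 2)); last by ring.
apply: homogeneous_lt => //.
have mkE : m * k = lambda^-1 by rewrite /k; field; apply/andP.
(* Since 0 < k < 1 + lambda, adding d either increases k or makes it smaller
   than - k. *)
have big : lambda^-1 ^+ 2 < (m * (k + d)) ^+ 2.
  rewrite -mkE !exprMn ltr_pM2l ?exprn_gt0 //.
  case: hd => hd; first by nra.
  by rewrite -[ltRHS]sqrrN ltr_sqr ?nnegrE; lra.
have qE : q = lambda^-1 - m by rewrite /m; ring.
(* The remaining gap m^2 + lambda^-2 - q^2 - 1 is 2 m / lambda - 1. *)
have half : 1 < 2 * (m * lambda^-1).
  have : 1 < lambda^-1 by rewrite invf_gt1.
  have : k < 2 by lra.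
  rewrite -mkE => k2 mk1.
  have : 1 < (m * k) ^+ 2 by rewrite exprn_egt1.
  nra.
rewrite qE; nra.
Qed.

Theorem theorem1 (R : realType) (lambda : R) (hlambda : 0 < lambda < 1)
  (r : option nat) (hr : r != Some 0%N)
  (g : R -> R) (hg : piecewise_smooth r g)
  (Gm Gp : set 'rV[R]_2)
  (hGp : Gp `<=` increasing_strips r g)
  (hGm : Gm `<=` decreasing_strips r g)
  (hG : open (Gm `|` Gp))
  (eps : R) (heps : 0 < eps)
  (hdp : forall p, Gp p -> eps <= g^`() (p 0 0))
  (hdm : forall p, Gm p -> g^`() (p 0 0) < - (2 * (1 + lambda))) :
  hyperbolic_with_cones (planar_map lambda g) (Gm `|` Gp)
    (unstable_cone lambda) (stable_cone lambda).
Proof.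
move=> p Gp_p.
have smooth_derivable (a b : R) :
    smooth_on r g `]a, b[ -> a < p 0 0 < b -> derivable g (p 0 0) 1.
  move=> sg pab; have [|+ _] := sg (p 0 0); first by rewrite /= in_itv.
  by move=> /(_ 0%N); apply; case: r hr {sg hg hGp hGm} => [[|]|].
have dg : derivable g (p 0 0) 1.
  by case: Gp_p => [/hGm|/hGp] [a [b [pab sg _]]]; exact: smooth_derivable _ _ sg pab.
have hd : 0 < g^`() (p 0 0) \/ g^`() (p 0 0) < - (2 * (1 + lambda)).
  by case: Gp_p => [/hdm|/hdp /(lt_le_trans heps)]; [right|left].
have l0 : lambda != 0 by case/andP: hlambda => /gt_eqF ->.
have [df unitJ linE linvE] := lin_planar_map _ _ _ _ l0 dg.
split=> //; first split.
- by move=> _ [u Ku <-]; rewrite linE; have [] := unstable_cone_step _ _ _ _ hlambda hd Ku.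
- by move=> _ [v Kv <-]; rewrite linvE; have [] := stable_cone_step _ _ _ _ hlambda hd Kv.
- by move=> u Ku; rewrite linE; have [] := unstable_cone_step _ _ _ _ hlambda hd Ku.
- by move=> v Kv; rewrite linvE; have [] := stable_cone_step _ _ _ _ hlambda hd Kv.
Qed.
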